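(* Let $K$ be a knot, i.e., a $1$-component link, and let $p$ be an odd prime. Let $m$ be an integer such that $K$ admits non-trivial $(p,m)$-colorings. If $m\neq 2$, or if $m=2$ but $\Delta^0_K(m)\neq 0$, then $$2+\lfloor \log_M p\rfloor \leq mincol_{p,m}(K),$$ where $M=\max\{|m|,|m-1|\}$ and $\log_M$ is the logarithm to base $M$.
   Context: Let $p$ be an odd prime and $m$ an integer not divisible by $p$, so that $a\ast b=ma+(1-m)b$ mod $p$ is a quandle operation on $\mathbf{Z}_p$ (the linear Alexander quandle). A $(p,m)$-coloring of an oriented knot or link diagram is an assignment of an element (color) of $\mathbf{Z}_p$ to each arc of the diagram such that at each crossing $c=ma+(1-m)b$ mod $p$, where $b$ is the color of the over-arc, $a$ is the color of the under-arc on the right of the over-arc (looking along the orientation of the over-arc) and $c$ is the color of the other under-arc (the choice of side is a fixed convention). The coloring is non-trivial if it uses at least two distinct colors. $K$ admits non-trivial $(p,m)$-colorings if some (equivalently, every) diagram of $K$ has one. For a knot $K$ admitting non-trivial $(p,m)$-colorings and a diagram $D$ of $K$, let $n_{D,p,m}$ be the minimum number of distinct colors used by a non-trivial $(p,m)$-coloring of $D$; then $mincol_{p,m}(K)=\min\{n_{D,p,m} : D \text{ is a diagram of } K\}$. The reduced Alexander polynomial $\Delta^0_K(T)$ is the representative of the (one-variable) Alexander polynomial of $K$, which is determined up to multiplication by $\pm T^n$, $n\in\mathbf{Z}$, whose value at $T=0$ is defined and positive (i.e., a polynomial in $\mathbf{Z}[T]$ with positive constant term). *)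

(* Defs.v *)
From mathcomp Require Import all_boot all_order all_algebra.
From mathcomp Require Import boolp classical_sets.
From Stdlib Require Import Relation_Operators.

Set Implicit Arguments.
Unset Strict Implicit.
Unset Printing Implicit Defensive.

Import GRing.Theory Num.Theory.

Local Open Scope ring_scope.

(* Oriented knots are taken up to Reidemeister moves on oriented diagrams on
   the sphere.  A diagram is encoded by its signed Gauss code: starting from a
   base point and following the orientation, one records every passage through
   a crossing.  Each crossing is thus recorded twice, once along its over-strand
   and once along its under-strand.  The empty code is the diagram without
   crossings. *)

(* ((name of the crossing, is this the over-passage), is the crossing positive) *)
Definition passage : Type := (nat * bool * bool)%type.
Definition crossing (x : passage) : nat := x.1.1.
Definition is_over (x : passage) : bool := x.1.2.
Definition is_under (x : passage) : bool := ~~ is_over x.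
Definition positive (x : passage) : bool := x.2.
Definition mate (x : passage) : passage := (crossing x, ~~ is_over x, positive x).

Definition gauss_code (w : seq passage) : bool :=
  uniq [seq (crossing x, is_over x) | x <- w] && all (fun x => mate x \in w) w.

(* A signed Gauss code determines a 4-valent graph cellularly embedded in a
   closed oriented surface; we require this surface to be a sphere.
   The dart (x, d) leaves the passage x along the knot, forwards if d and
   backwards otherwise, towards the passage y.  There the boundary of the face
   on the left is followed by turning left onto the other strand of the
   crossing.  In a positive crossing the under-strand runs from right to left
   of the over-strand, so the strand of mate y crosses the strand of y from
   right to left iff is_over y == positive y. *)
Definition turn_left (w : seq passage) (e : passage * bool) : passage * bool :=
  let y := if e.2 then next w e.1 else prev w e.1 in
  (mate y, e.2 == (is_over y == positive y)).

Definition darts (w : seq passage) : seq (passage * bool) :=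
  [seq (x, d) | x <- w, d <- [:: true; false]].

Definition face (w : seq passage) (e : passage * bool) : seq (passage * bool) :=
  [seq e' <- darts w | e' \in traject (turn_left w) e (size (darts w))].

Definition faces (w : seq passage) : seq (seq (passage * bool)) :=
  undup [seq face w e | e <- darts w].

(* Euler's formula V - E + F = 2, where E = size w and V = E / 2. *)
Definition spherical (w : seq passage) : bool :=
  (w == [::]) || ((size w)./2 + size (faces w) == size w + 2)%N.

Record diagram : Type := Diagram {
  code :> seq passage;
  code_gauss : gauss_code code;
  code_spherical : spherical code }.

(* The three strands of a Reidemeister III triangle: the top strand passes over
   the middle one at a and over the bottom one at b, and the middle strand
   passes over the bottom one at c; ea, eb, ec tell whether a, b, c are
   positive, and d tells whether c is on the right of the top strand.
   Signs being encoded with true for +1, their product is ==.  For three straight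
   lines in general position, a comes after c on the middle strand iff
   d * ea = +1, b comes after c on the bottom strand iff d * eb = +1, and a
   comes after b on the top strand iff d * ea * eb * ec = +1.  The move slides
   the top strand across c, that is, negates d. *)
Definition in_order (t : bool) (x y : passage) : seq passage :=
  if t then [:: x; y] else [:: y; x].

Definition top_strand (a b c : nat) (ea eb ec d : bool) : seq passage :=
  in_order ((d == ea) == (eb == ec)) (b, true, eb) (a, true, ea).
Definition middle_strand (a b c : nat) (ea eb ec d : bool) : seq passage :=
  in_order (d == ea) (c, true, ec) (a, false, ea).
Definition bottom_strand (a b c : nat) (ea eb ec d : bool) : seq passage :=
  in_order (d == eb) (c, false, ec) (b, false, eb).

(* The moves only make sense between Gauss codes, which forces the names of the
   crossings that they create to be fresh. *)
Inductive move : seq passage -> seq passage -> Prop :=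
| move_rotate k w : move w (rot k w)
| move_rename (f : nat -> nat) w : injective f ->
    move w [seq (f (crossing x), is_over x, positive x) | x <- w]
| move_R1 a o s u v :
    move (u ++ v) (u ++ [:: (a, o, s); (a, ~~ o, s)] ++ v)
| move_R2 a b s t u v w :
    move (u ++ v ++ w)
         (u ++ [:: (a, true, s); (b, true, ~~ s)]
            ++ v ++ in_order t (a, false, s) (b, false, ~~ s) ++ w)
| move_R3_tmb a b c ea eb ec d u v w :
    move (top_strand a b c ea eb ec d ++ u
            ++ middle_strand a b c ea eb ec d ++ v
            ++ bottom_strand a b c ea eb ec d ++ w)
         (top_strand a b c ea eb ec (~~ d) ++ u
            ++ middle_strand a b c ea eb ec (~~ d) ++ v
            ++ bottom_strand a b c ea eb ec (~~ d) ++ w)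
| move_R3_tbm a b c ea eb ec d u v w :
    move (top_strand a b c ea eb ec d ++ u
            ++ bottom_strand a b c ea eb ec d ++ v
            ++ middle_strand a b c ea eb ec d ++ w)
         (top_strand a b c ea eb ec (~~ d) ++ u
            ++ bottom_strand a b c ea eb ec (~~ d) ++ v
            ++ middle_strand a b c ea eb ec (~~ d) ++ w).

Definition reidemeister : diagram -> diagram -> Prop :=
  clos_refl_sym_trans diagram (fun D E => move D E).

Record knot : Type := Knot {
  diagrams_of :> diagram -> Prop;
  diagrams_ofP : exists D, diagrams_of = reidemeister D }.

(* The arcs run from one under-passage to the next one; they are numbered from
   the base point, which lies on arc 0.  There are as many arcs as crossings,
   except that the diagram without crossings has one arc. *)
Definition unders (w : seq passage) : seq passage := [seq x <- w | is_under x].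
Definition narcs (w : seq passage) : nat := (size (unders w)).-1.+1.

(* The arc carrying the edge that arrives at the i-th passage. *)
Definition arc_at (w : seq passage) (i : nat) : 'I_(narcs w) :=
  inZp (count is_under (take i w)).

(* In what follows x is an under-passage.  At a positive crossing the
   under-strand arrives from the right of the over-strand, at a negative
   crossing it leaves to the right. *)
Definition over_arc (w : seq passage) (x : passage) : 'I_(narcs w) :=
  arc_at w (index (mate x) w).
Definition right_under (w : seq passage) (x : passage) : 'I_(narcs w) :=
  arc_at w (index x w + ~~ positive x).
Definition left_under (w : seq passage) (x : passage) : 'I_(narcs w) :=
  arc_at w (index x w + positive x).

Definition pm_coloring (p : nat) (m : int) (D : diagram)
    (f : {ffun 'I_(narcs D) -> 'F_p}) : Prop :=
  forall x, x \in unders D ->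
    f (left_under D x)
    = m%:~R * f (right_under D x) + (1 - m)%:~R * f (over_arc D x).

Definition ncolors (p n : nat) (f : {ffun 'I_n -> 'F_p}) : nat := #|codom f|.

Definition nontrivial_coloring (p : nat) (m : int) (D : diagram)
    (f : {ffun 'I_(narcs D) -> 'F_p}) : Prop :=
  pm_coloring m f /\ (2 <= ncolors f)%N.

Definition admits_nontrivial_colorings (p : nat) (m : int) (K : knot) : Prop :=
  exists2 D, K D & exists f : {ffun 'I_(narcs D) -> 'F_p},
    nontrivial_coloring m f.

(* The least element of S, and 0 if S is empty. *)
Definition least (S : set nat) : nat :=
  xget 0%N (fun n => S n /\ forall k, S k -> (n <= k)%N).

Lemma leastP (S : set nat) n : S n -> S (least S) /\ (least S <= n)%N.
Proof.
move=> Sn; have exS : exists k, `[< S k >] by exists n; apply/asboolP.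
have [l /asboolP Sl lmin] := ex_minnP exS.
have Pl : S l /\ forall k, S k -> (l <= k)%N.
  by split=> // k Sk; apply/lmin/asboolP.
by rewrite /least; case: xgetP => [k _ [Sk kmin]|/(_ l)//]; split; auto.
Qed.

Definition min_colors (p : nat) (m : int) (D : diagram) : nat :=
  least (fun n => exists2 f : {ffun 'I_(narcs D) -> 'F_p},
    nontrivial_coloring m f & n = ncolors f).

Definition mincol (p : nat) (m : int) (K : knot) : nat :=
  least (fun n => exists2 D, K D & n = min_colors p m D).

(* The presentation matrix of the Alexander module with one generator per arc
   and, at each crossing, the relation T a + (1 - T) b - c where b is the
   over-arc and a, c are the right and left under-arcs. *)
Definition alexander_matrix (w : seq passage) :
    'M[{poly int}]_(size (unders w), narcs w) :=
  \matrix_(i, j)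
    let x := tnth (in_tuple (unders w)) i in
    'X *+ (j == right_under w x) + (1 - 'X) *+ (j == over_arc w x)
    - 1 *+ (j == left_under w x).

(* Divisibility in Z[T, 1/T]. *)
Definition laurent_dvd (P Q : {poly int}) : Prop :=
  exists k R, 'X^k * Q = P * R.

Definition minor (w : seq passage) (g : 'I_(narcs w).-1 -> 'I_(size (unders w)))
    (h : 'I_(narcs w).-1 -> 'I_(narcs w)) : {poly int} :=
  \det (mxsub g h (alexander_matrix w)).

(* The Alexander polynomial generates the smallest principal ideal of
   Z[T, 1/T] containing the first elementary ideal of the Alexander module. *)
Definition is_alexander (D : diagram) (P : {poly int}) : Prop :=
  (forall g h, laurent_dvd P (@minor D g h)) /\
  (forall Q, (forall g h, laurent_dvd Q (@minor D g h)) -> laurent_dvd Q P).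

(* The conditions characterize the polynomial: the Alexander polynomial does not
   depend on the diagram, up to a unit of Z[T, 1/T], that is, some +-T^n. *)
Definition reduced_alexander (K : knot) : {poly int} :=
  xget 0 (fun P => (exists2 D, K D & is_alexander D P) /\ 0 < P.[0]).

(* Main.v *)
Require Import Defs.
From mathcomp Require Import all_boot all_order all_algebra.
From mathcomp Require Import boolp classical_sets ring zify.
From Stdlib Require Import Relation_Operators.

(* Let n be the number of colors of a non-trivial (p,m)-coloring of a diagram.
   Taking the colors as unknowns, the crossings give an integer linear system
   in n unknowns, each equation having coefficients 1, -m, m - 1.  Modulo p it has
   a non-constant solution, so p divides all its minors of order n - 1.  If one
   of them is nonzero, then p is at most its absolute value.  Every row is an
   edge vector e_a - e_b plus M - 1 times another one, and matrices of edge
   vectors have determinant 0, 1 or -1, so the minor is at most M^(n-1); moreover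
   p <> M^(n-1) because p is prime and n >= 3.

   If all these minors vanish, then the diagram has a non-constant coloring by
   rational numbers, so all the first minors of the Alexander matrix vanish at
   T = m.  When m is not 0, 1 or 2, reducing them modulo a prime divisor q of
   m - 1 gives a non-constant coloring over F_q with m = 1, which is impossible
   since all arcs of a knot are then of the same color.  When m = 2, the
   polynomial X - 2 divides the Alexander polynomial.  That both conditions
   (non-constant colorings over F_p, over the rationals) hold for all the diagrams
   of the knot at once is checked on the Reidemeister moves. *)

Set Implicit Arguments.
Unset Strict Implicit.
Unset Printing Implicit Defensive.

Import Order.TTheory GRing.Theory Num.Theory.

Local Open Scope ring_scope.

(** * Invariance of colorings under Reidemeister moves *)

Section Colorings.

Variables (F : fieldType) (t : F).
Hypothesis t_neq0 : t != 0.

(* The color found across an under-passage whose over-arc is colored b, when one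
   arrives with the color c; e tells whether the crossing is positive. *)
Definition slide (e : bool) (b c : F) : F :=
  b + (if e then t else t^-1) * (c - b).

Lemma slideb e b : slide e b b = b.
Proof. by rewrite /slide subrr mulr0 addr0. Qed.

Lemma slideK e b : cancel (slide e b) (slide (~~ e) b).
Proof. by move=> c; rewrite /slide; case: e => /=; field. Qed.

Lemma slideKN e b : cancel (slide (~~ e) b) (slide e b).
Proof. by move=> c; rewrite -{1}[e]negbK slideK. Qed.

Lemma slide_inj e b : injective (slide e b).
Proof. exact: can_inj (slideK e b). Qed.

Lemma slide_eqr e b c : (slide e b c == b) = (c == b).
Proof. by rewrite -{2}(slideb e b) (inj_eq (@slide_inj e b)). Qed.

Lemma slide_eq e b c c' : (slide e b c == c') = (c == slide (~~ e) b c').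
Proof. exact: can2_eq (slideK e b) (slideKN e b) c c'. Qed.

(** Self-distributivity of the quandle, also for mixed signs: the algebraic content of the third
    Reidemeister move. *)
Lemma slideD e e' a b c :
  slide e a (slide e' b c) = slide e' (slide e a b) (slide e a c).
Proof. by rewrite /slide; ring. Qed.

Definition pass (h : nat -> F) (c : F) (x : passage) : F :=
  if is_over x then c else slide (positive x) (h (crossing x)) c.

(* A coloring is encoded by the color c at the base point and the colors h of the
   over-arcs at the crossings, which determine the other colors one after the
   other along the knot. *)
Definition run (h : nat -> F) : F -> seq passage -> F := foldl (pass h).

Fixpoint consistent (h : nat -> F) (c : F) (w : seq passage) : bool :=
  if w is x :: w' then
    (is_over x ==> (h (crossing x) == c)) && consistent h (pass h c x) w'
  else true.

Definition coloring h c w := consistent h c w && (run h c w == c).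

Definition constant_on h (c : F) (w : seq passage) :=
  all (fun x => h (crossing x) == c) w.

(** Rigidity is the absence of non-constant colorings; looking at [h] suffices, by
    [run_constant]. *)
Definition rigid w := forall h c, coloring h c w -> constant_on h c w.

Lemma run_cat h c u v : run h c (u ++ v) = run h (run h c u) v.
Proof. exact: foldl_cat. Qed.

Lemma consistent_cat h c u v :
  consistent h c (u ++ v) = consistent h c u && consistent h (run h c u) v.
Proof. by elim: u c => //= x u IHu c; rewrite IHu andbA. Qed.

Lemma constant_on_cat h c u v :
  constant_on h c (u ++ v) = constant_on h c u && constant_on h c v.
Proof. exact: all_cat. Qed.

Lemma run_constant h c w : constant_on h c w -> run h c w = c.
Proof.
elim: w => //= x w IHw /andP[/eqP hx /IHw].
by rewrite /pass hx slideb if_same.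
Qed.

Lemma eq_colors h h' c w : {in w, forall x, h (crossing x) = h' (crossing x)} ->
  (run h c w = run h' c w) * (consistent h c w = consistent h' c w)
  * (constant_on h c w = constant_on h' c w).
Proof.
move=> eq_h; split; last by apply: eq_in_all => x /eq_h->.
elim: w c eq_h => //= x w IHw c eq_h.
have eq_w: {in w, forall y, h (crossing y) = h' (crossing y)}.
  by move=> y wy; rewrite eq_h // inE wy orbT.
have hx: h (crossing x) = h' (crossing x) by rewrite eq_h ?mem_head.
by rewrite /pass hx; split; rewrite IHw.
Qed.

Definition recolor (h : nat -> F) (a : nat) (y : F) (b : nat) : F :=
  if b == a then y else h b.

Definition avoids (a : nat) (w : seq passage) := a \notin [seq crossing x | x <- w].

Lemma recolorE h a y c w : avoids a w ->
  (run (recolor h a y) c w = run h c w)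
  * (consistent (recolor h a y) c w = consistent h c w)
  * (constant_on (recolor h a y) c w = constant_on h c w).
Proof.
move=> aw; apply: eq_colors => x wx; rewrite /recolor; case: eqP => // xa.
by case/negP: aw; rewrite -xa map_f.
Qed.

Definition key (x : passage) := (crossing x, is_over x).

(** Keys are distinct and a crossing has only two, so both are used up by [u]. *)
Lemma avoidsP a u w : uniq [seq key x | x <- u ++ w] ->
  (a, true) \in [seq key x | x <- u] -> (a, false) \in [seq key x | x <- u] ->
  avoids a w.
Proof.
rewrite map_cat cat_uniq => /and3P[_ /hasPn dis _] uT uF.
apply/mapP => -[x wx xa]; have /dis /= := map_f key wx.
by rewrite /key -xa; case: (is_over x); rewrite ?uT ?uF.
Qed.

Lemma avoids_cat a u v : avoids a (u ++ v) = avoids a u && avoids a v.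
Proof. by rewrite /avoids map_cat mem_cat negb_or. Qed.

(** * Change of base point, renaming, and the first two Reidemeister moves *)

Lemma rigid_rot k w : rigid w -> rigid (rot k w).
Proof.
move=> wR h c /andP[]; rewrite consistent_cat => /andP[d_ok t_ok].
rewrite run_cat => /eqP c_eq; set c' := run h c (drop k w).
have /wR: coloring h c' w.
  rewrite /coloring -[w in consistent _ _ w](cat_take_drop k) consistent_cat.
  rewrite t_ok c_eq d_ok /=.
  by rewrite -[w in run _ _ w](cat_take_drop k) run_cat c_eq.
move=> w_c'; have: constant_on h c' (take k w).
  move: w_c'; rewrite -[w in constant_on _ _ w](cat_take_drop k).
  by rewrite constant_on_cat => /andP[].
move/run_constant; rewrite c_eq => ->.
by rewrite /constant_on /rot all_cat andbC -all_cat cat_take_drop.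
Qed.

Lemma rigid_rotE k w : rigid (rot k w) <-> rigid w.
Proof.
split; last exact: rigid_rot.
by move/(@rigid_rot (size (rot k w) - k)); rewrite -/(rotr k _) rotK.
Qed.

Lemma rename_colors (f : nat -> nat) h c w :
  let w' := [seq (f (crossing x), is_over x, positive x) | x <- w] in
  (run h c w' = run (h \o f) c w) *
  (consistent h c w' = consistent (h \o f) c w) *
  (constant_on h c w' = constant_on (h \o f) c w).
Proof.
split; last by rewrite /constant_on all_map.
by elim: w c => //= x w IHw c; split; rewrite IHw.
Qed.

Lemma rigid_rename (f : nat -> nat) w : injective f ->
  rigid [seq (f (crossing x), is_over x, positive x) | x <- w] <-> rigid w.
Proof.
move=> f_inj; set cs := [seq crossing x | x <- w]; split=> wR h c; last first.
  by rewrite /coloring !rename_colors => /wR.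
(* [h] composed with an inverse of [f] on the names that occur in [w]. *)
pose h' a := h (nth 0%N cs (index a (map f cs))).
have hh' : {in w, forall x, h (crossing x) = (h' \o f) (crossing x)}.
  move=> x wx; rewrite /h' /= index_map // nth_index //; exact: map_f.
rewrite /coloring !(eq_colors _ hh').
by have := wR h' c; rewrite /coloring !rename_colors.
Qed.

(** The kink forces [h a] to be the arriving color and then leaves this color unchanged, so the rest
    of the coloring determines [h a]. *)
Lemma rigid_R1 a o s u v :
  uniq [seq key x | x <- u ++ [:: (a, o, s); (a, ~~ o, s)] ++ v] ->
  rigid (u ++ [:: (a, o, s); (a, ~~ o, s)] ++ v) <-> rigid (u ++ v).
Proof.
set k := [:: _; _] => w_uniq.
have: avoids a (u ++ v).
  apply: (@avoidsP a k); last 2 first.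
  - by rewrite /k; case: (o); rewrite !inE /key /= eqxx ?orbT.
  - by rewrite /k; case: (o); rewrite !inE /key /= eqxx ?orbT.
  by rewrite (perm_uniq (perm_map key (permEl (perm_catCA k u v)))).
rewrite avoids_cat => /andP[au av].
have kE h c : consistent h c k = (h a == c).
  rewrite /k; case: (o); rewrite /= ?andbT //= /pass /=.
  by rewrite eq_sym slide_eqr eq_sym.
have kR h c : h a == c -> run h c k = c.
  by move/eqP=> <-; rewrite /k /run; case: (o); rewrite /= /pass /= slideb.
split=> wR h c; rewrite /coloring !consistent_cat !run_cat.
  move=> /andP[/andP[u_ok v_ok] run_ok].
  pose h' := recolor h a (run h c u).
  have /wR: coloring h' c (u ++ k ++ v).
    have h'a : h' a == run h c u by rewrite /h' /recolor eqxx.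
    rewrite /coloring !consistent_cat !run_cat !(recolorE h _ _ au) u_ok kE kR //.
    by rewrite h'a !(recolorE h _ _ av) v_ok.
  rewrite !constant_on_cat.
  by rewrite !(recolorE h _ _ au) !(recolorE h _ _ av) => /and3P[-> _ ->].
move=> /andP[/and3P[u_ok k_ok v_ok] run_ok].
move: k_ok v_ok run_ok; rewrite kE => ha; rewrite kR // => v_ok run_ok.
have: constant_on h c (u ++ v).
  by apply: wR; rewrite /coloring consistent_cat run_cat u_ok v_ok.
rewrite !constant_on_cat => /andP[u_c ->].
by rewrite u_c andbT /k /= (eqP ha) (run_constant u_c) !eqxx.
Qed.

(** Both crossings take the color of the over-strand and have opposite signs, so the two slides of
    the under-strand cancel. *)
Lemma rigid_R2 a b s o u v w :
  let k := [:: (a, true, s); (b, true, ~~ s)] in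
  let l := in_order o (a, false, s) (b, false, ~~ s) in
  uniq [seq key x | x <- u ++ k ++ v ++ l ++ w] ->
  rigid (u ++ k ++ v ++ l ++ w) <-> rigid (u ++ v ++ w).
Proof.
move=> k l w_uniq.
have uniq_kl: uniq [seq key x | x <- (k ++ l) ++ (u ++ v ++ w)].
  rewrite -(perm_uniq (perm_map key (_ : perm_eq (u ++ k ++ v ++ l ++ w) _))) //.
  by rewrite perm_catCA -catA perm_cat2l perm_sym perm_catCA perm_cat2l perm_catCA.
have: avoids a (u ++ v ++ w).
  by apply: avoidsP uniq_kl _ _; rewrite /k /l; case: (o);
    rewrite !inE /key /= eqxx ?orbT.
have: avoids b (u ++ v ++ w).
  by apply: avoidsP uniq_kl _ _; rewrite /k /l; case: (o);
    rewrite !inE /key /= eqxx ?orbT.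
rewrite !avoids_cat => /and3P[bu bv bw] /and3P[au av aw].
have kE h c : consistent h c k = (h a == c) && (h b == c) by rewrite /= andbT.
have lE h c : consistent h c l by rewrite /l; case: (o).
have kR h c : run h c k = c by [].
have lR h c : h a = h b -> run h c l = c.
  by rewrite /l /run => hab; case: (o); rewrite /= /pass /= hab ?slideK ?slideKN.
split=> wR h c; rewrite /coloring !consistent_cat !run_cat.
  move=> /andP[/and3P[u_ok v_ok w_ok] run_ok].
  pose x := run h c u; pose h' := recolor (recolor h a x) b x.
  have h'a : h' a = x by rewrite /h' /recolor eqxx if_same.
  have h'b : h' b = x by rewrite /h' /recolor eqxx.
  have /wR: coloring h' c (u ++ k ++ v ++ l ++ w).
    rewrite /coloring !consistent_cat !run_cat kR kE lR ?h'a ?h'b // lE.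
    by rewrite /h' !(recolorE, u_ok, v_ok, w_ok, eqxx).
  rewrite !constant_on_cat.
  rewrite /h' !(recolorE _ _ _ bu, recolorE _ _ _ bv, recolorE _ _ _ bw).
  rewrite !(recolorE _ _ _ au, recolorE _ _ _ av, recolorE _ _ _ aw).
  by case/and5P=> -> _ -> _ ->.
rewrite kE kR lE.
move=> /andP[/and5P[u_ok /andP[/eqP ha /eqP hb] v_ok _]].
rewrite lR ?ha // => w_ok run_ok.
have: constant_on h c (u ++ v ++ w).
  by apply: wR; rewrite /coloring !consistent_cat !run_cat u_ok v_ok w_ok.
rewrite !constant_on_cat => /and3P[u_c v_c w_c].
rewrite u_c v_c w_c /= /l; case: (o);
by rewrite /= /crossing /= ha hb (run_constant u_c) eqxx.
Qed.

(** * The third Reidemeister move *)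

Section R3.

Variables (a b c : nat) (ea eb ec : bool).
Hypotheses (aNc : a != c) (bNc : b != c).

Let top := top_strand a b c ea eb ec.
Let mid := middle_strand a b c ea eb ec.
Let bot := bottom_strand a b c ea eb ec.

Lemma run_top h x d : run h x (top d) = x.
Proof. by rewrite /top /top_strand /in_order; case: ifP. Qed.

Lemma consistent_top h x d :
  consistent h x (top d) = (h a == x) && (h b == x).
Proof.
by rewrite /top /top_strand /in_order; case: ifP => _ /=; rewrite andbT // andbC.
Qed.

Variables (h : nat -> F) (d : bool).
Hypothesis hab : h a = h b.

(* The over-color of the middle strand at c is the only color that the move
   changes: c and the passage under the top strand are exchanged. *)
Let h' := recolor h c (slide d (h a) (h c)).

Lemma run_mid y : run h' y (mid (~~ d)) = run h y (mid d).
Proof.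
rewrite /mid /middle_strand /in_order /run.
by case: d; case: ea; rewrite /= /pass /= /h' /recolor (negPf aNc).
Qed.

(** The middle strand meets [c] before [a] iff [d == ea]. The move then slides the color at [c]
    forwards past [a], otherwise backwards; both amount to [slide d]. *)
Lemma consistent_mid y : consistent h' y (mid (~~ d)) = consistent h y (mid d).
Proof.
rewrite /mid /middle_strand /in_order /h'; case: d; case: ea;
rewrite /= /pass /= /recolor /crossing /= eqxx ?(negPf aNc) !andbT
  ?(inj_eq (@slide_inj _ _)) //;
by rewrite slide_eq.
Qed.

(** Passing under the top and middle strands in the other order gives the same color by [slideD], as
    [h'] moves the middle color across the top strand. *)
Lemma run_bot z : run h' z (bot (~~ d)) = run h z (bot d).
Proof.
rewrite /bot /bottom_strand /in_order /run /h'; case: d; case: eb;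
  rewrite /= /pass /= /recolor /crossing /= eqxx ?(negPf bNc) hab //;
  first [by rewrite -slideD | by rewrite slideD ?(slideK true) ?(slideK false)].
Qed.

Lemma consistent_bot g z e : consistent g z (bot e).
Proof. by rewrite /bot /bottom_strand /in_order; case: ifP. Qed.

Lemma constant_on_top x :
  constant_on h' x (top (~~ d)) -> (h a = x) * constant_on h x (top d).
Proof.
rewrite /top /top_strand /in_order /h' /recolor.
by case: ifP; case: ifP => _ _ /=; rewrite /crossing /= (negPf aNc) (negPf bNc);
  case/and3P=> /eqP-> /eqP->; rewrite !eqxx.
Qed.

Lemma constant_on_mid x : h a = x ->
  constant_on h' x (mid (~~ d)) -> (h c = x) * constant_on h x (mid d).
Proof.
move=> hax; have h'c : h' c == x -> h c = x.
  by rewrite /h' /recolor eqxx hax slide_eqr => /eqP.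
rewrite /mid /middle_strand /in_order.
by case: ifP; case: ifP => _ _ /=; rewrite /crossing /= => /and3P[];
  [move/h'c=> hcx _|move/h'c=> hcx _|move=> _ /h'c hcx|move=> _ /h'c hcx];
  rewrite hax hcx !eqxx.
Qed.

Lemma constant_on_bot x : h a = x -> h c = x -> constant_on h x (bot d).
Proof.
rewrite /bot /bottom_strand /in_order hab => hbx hcx.
by case: ifP => _ /=; rewrite /crossing /= hbx hcx !eqxx.
Qed.

End R3.

Lemma R3_crossings a b c ea eb ec d u :
  let k := top_strand a b c ea eb ec d ++ middle_strand a b c ea eb ec d
    ++ bottom_strand a b c ea eb ec d in
  uniq [seq key x | x <- k ++ u] -> [/\ a != c, b != c & avoids c u].
Proof.
move=> k uniq_ku; split; last 1 first.
- by apply: avoidsP uniq_ku _ _; rewrite /k /top_strand /middle_strand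
    /bottom_strand /in_order; do 3![case: ifP => _ /=]; rewrite !inE /key /= eqxx ?orbT.
all: apply/eqP=> ac; move: uniq_ku; rewrite map_cat cat_uniq => /andP[+ _];
  by rewrite /k ac /top_strand /middle_strand /bottom_strand /in_order;
  do 3![case: ifP => _ /=]; rewrite !inE /key /= eqxx ?(orbT, andbF).
Qed.

(** Recoloring [c] turns a coloring of one side into one of the other. One implication is enough:
    negating [d] exchanges the two sides. *)
Lemma rigid_R3_tmb a b c ea eb ec d u v w :
  let k d' := top_strand a b c ea eb ec d' ++ u
    ++ middle_strand a b c ea eb ec d' ++ v
    ++ bottom_strand a b c ea eb ec d' ++ w in
  uniq [seq key x | x <- k d] -> rigid (k (~~ d)) -> rigid (k d).
Proof.
move=> k k_uniq kR h x.
have [|aNc bNc] := @R3_crossings a b c ea eb ec d (u ++ v ++ w).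
  set l := (X in uniq [seq _ | _ <- X]).
  rewrite -(perm_uniq (perm_map key (_ : perm_eq (k d) l))) // /k /l -!catA.
  by rewrite perm_cat2l perm_catCA perm_cat2l perm_sym perm_catCA perm_cat2l perm_catCA.
rewrite !avoids_cat => /and3P[uc vc wc].
rewrite /coloring !consistent_cat !run_cat run_top consistent_top.
move=> /andP[/and3P[/andP[/eqP ha /eqP hb] u_ok]].
move=> /and4P[mid_ok v_ok _ w_ok] run_ok.
have hab : h a = h b by rewrite ha.
set h' := recolor h c (slide d (h a) (h c)).
have /kR: coloring h' x (k (~~ d)).
  rewrite /coloring !consistent_cat !run_cat run_top consistent_top.
  rewrite !(recolorE _ _ _ uc) !(recolorE _ _ _ vc) !(recolorE _ _ _ wc).
  rewrite run_mid // consistent_mid // run_bot // consistent_bot.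
  rewrite u_ok mid_ok v_ok w_ok run_ok.
  by rewrite /h' /recolor (negPf aNc) (negPf bNc) ha hb eqxx.
rewrite !constant_on_cat !(recolorE _ _ _ uc) !(recolorE _ _ _ vc) !(recolorE _ _ _ wc).
move=> /and5P[/(constant_on_top aNc bNc)[hax ->] ->].
by move=> /(constant_on_mid hax)[hcx ->] -> /andP[_ ->]; rewrite constant_on_bot.
Qed.

Lemma rigid_R3_tbm a b c ea eb ec d u v w :
  let k d' := top_strand a b c ea eb ec d' ++ u
    ++ bottom_strand a b c ea eb ec d' ++ v
    ++ middle_strand a b c ea eb ec d' ++ w in
  uniq [seq key x | x <- k d] -> rigid (k (~~ d)) -> rigid (k d).
Proof.
move=> k k_uniq kR h x.
have [|aNc bNc] := @R3_crossings a b c ea eb ec d (u ++ v ++ w).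
  set l := (X in uniq [seq _ | _ <- X]).
  rewrite -(perm_uniq (perm_map key (_ : perm_eq (k d) l))) // /k /l -!catA.
  rewrite perm_cat2l perm_sym perm_catCA perm_sym perm_catCA perm_cat2l.
  by rewrite perm_sym perm_catCA perm_cat2l perm_catCA.
rewrite !avoids_cat => /and3P[uc vc wc].
rewrite /coloring !consistent_cat !run_cat run_top consistent_top.
move=> /andP[/and3P[/andP[/eqP ha /eqP hb] u_ok]].
move=> /and4P[_ v_ok mid_ok w_ok] run_ok.
have hab : h a = h b by rewrite ha.
set h' := recolor h c (slide d (h a) (h c)).
have /kR: coloring h' x (k (~~ d)).
  rewrite /coloring !consistent_cat !run_cat run_top consistent_top.
  rewrite !(recolorE _ _ _ uc) !(recolorE _ _ _ vc) !(recolorE _ _ _ wc).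
  rewrite run_mid // consistent_mid // run_bot // consistent_bot.
  rewrite u_ok mid_ok v_ok w_ok run_ok.
  by rewrite /h' /recolor (negPf aNc) (negPf bNc) ha hb eqxx.
rewrite !constant_on_cat !(recolorE _ _ _ uc) !(recolorE _ _ _ vc) !(recolorE _ _ _ wc).
move=> /and5P[/(constant_on_top aNc bNc)[hax ->] -> _ ->].
by move=> /andP[/(constant_on_mid hax)[hcx ->] ->]; rewrite constant_on_bot.
Qed.


Lemma rigid_move w w' : gauss_code w -> gauss_code w' -> move w w' ->
  rigid w <-> rigid w'.
Proof.
move=> /andP[w_uniq _] /andP[w'_uniq _] ww'.
case: ww' w_uniq w'_uniq => {w w'}.
- by move=> k w _ _; split=> /rigid_rotE.
- by move=> f w f_inj _ _; split=> /(rigid_rename _ f_inj).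
- by move=> a o s u v _ /rigid_R1 w_iff; split=> /w_iff.
- by move=> a b s o u v w _ /rigid_R2 w_iff; split=> /w_iff.
- move=> a b c ea eb ec d u v w w_uniq w'_uniq; split.
    by rewrite -{1 2 3}[d]negbK; apply: rigid_R3_tmb.
  exact: rigid_R3_tmb.
- move=> a b c ea eb ec d u v w w_uniq w'_uniq; split.
    by rewrite -{1 2 3}[d]negbK; apply: rigid_R3_tbm.
  exact: rigid_R3_tbm.
Qed.

Lemma rigid_reidemeister (D E : diagram) : reidemeister D E ->
  rigid D <-> rigid E.
Proof.
elim=> {D E} [D E DE|D|D E _ IH|D1 D2 D3 _ IH1 _ IH2] //.
- exact: rigid_move (code_gauss D) (code_gauss E) DE.
- exact: iff_sym.
- exact: iff_trans IH1 IH2.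
Qed.

End Colorings.

(** * Colorings of the arcs *)

Definition arc_coloring (F : fieldType) (t : F) (w : seq passage)
    (f : 'I_(narcs w) -> F) : Prop :=
  forall x, x \in unders w ->
    f (left_under w x) = t * f (right_under w x) + (1 - t) * f (over_arc w x).

(** The count grows by at most 1 at each step, so no value is skipped; hence every arc is met along
    the knot. *)
Lemma count_take_surj (T : Type) (P : pred T) (s : seq T) j :
  (j <= count P s)%N -> exists2 i, (i <= size s)%N & count P (take i s) = j.
Proof.
elim: s j => [|x s IHs] [|j]; rewrite ?leqn0 //=; try by exists 0%N.
case: (boolP (P x)) => Px; rewrite ?add0n ?add1n ?ltnS => /IHs[i le_i <-];
  by exists i.+1; rewrite //= ?Px ?(negPf Px).
Qed.

Section Arcs.

Variables (F : fieldType) (t : F).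
Hypothesis t_neq0 : t != 0.
Variable w : seq passage.
Hypothesis w_gauss : gauss_code w.

Let x0 : passage := (0%N, true, true).

Lemma uniq_keys : uniq [seq key x | x <- w].
Proof. by case/andP: w_gauss. Qed.

Lemma mem_mate x : x \in w -> mate x \in w.
Proof. by case/andP: w_gauss => _ /allP; apply. Qed.

Lemma over_ind (P : nat -> Prop) :
  (forall x, x \in w -> is_over x -> P (crossing x)) ->
  forall x, x \in w -> P (crossing x).
Proof.
move=> Pover x wx; case: (boolP (is_over x)) => [|/= Nx]; first exact: Pover.
by apply: (Pover (mate x)); first exact: mem_mate.
Qed.

(** Used to locate a passage whose sign is not known. *)
Lemma index_key x : x \in w -> index (key x) [seq key y | y <- w] = index x w.
Proof.
move=> wx; rewrite -{1}(nth_index x0 wx) -(nth_map _ (key x0)) ?index_mem //.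
by rewrite index_uniq ?uniq_keys // size_map index_mem.
Qed.

Lemma consistentP (h : nat -> F) c u :
  reflect (forall i, (i < size u)%N -> is_over (nth x0 u i) ->
             h (crossing (nth x0 u i)) = run t h c (take i u))
          (consistent t h c u).
Proof.
elim: u c => [|x u IHu] c /=; first by left.
apply: (iffP andP) => [[/implyP x_ok /IHu u_ok] [|i] //= le_i|u_ok].
- by move=> /x_ok/eqP.
- exact: u_ok.
split; first by apply/implyP=> Ox; apply/eqP/(u_ok 0%N).
by apply/IHu=> i lt_i; apply: (u_ok i.+1).
Qed.

Lemma arc_at0 : arc_at w 0 = ord0.
Proof. by apply: val_inj; rewrite /= take0 mod0n. Qed.

Lemma arc_at_size : arc_at w (size w) = ord0.
Proof.
apply: val_inj; rewrite /= take_size -size_filter -/(unders w).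
by case: (size _) => [|n]; rewrite /= ?modnn.
Qed.

Lemma arc_at_surj (j : 'I_(narcs w)) : exists2 i, (i <= size w)%N & j = arc_at w i.
Proof.
have lt_j: (j <= count is_under w)%N.
  rewrite -size_filter -/(unders w); case: j => j /=; rewrite /narcs.
  by case: (size _) => [|n] /=; [case: j | move/ltnW].
have [i le_i ij] := count_take_surj lt_j.
by exists i => //; apply: val_inj; rewrite /= ij modn_small.
Qed.

Lemma arc_atS i : (i < size w)%N -> is_over (nth x0 w i) ->
  arc_at w i.+1 = arc_at w i.
Proof.
move=> lt_i Oi; rewrite /arc_at (take_nth x0) // -cats1 count_cat /=.
by rewrite /is_under Oi /= !addn0.
Qed.

Lemma index_nth i : (i < size w)%N -> index (nth x0 w i) w = i.
Proof. by move=> lt_i; rewrite index_uniq // (map_uniq uniq_keys). Qed.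

Lemma runS (h : nat -> F) c i : (i < size w)%N ->
  run t h c (take i.+1 w) = pass t h (run t h c (take i w)) (nth x0 w i).
Proof. by move=> lt_i; rewrite (take_nth x0) // /run foldl_rcons. Qed.

(** A slide relates arriving and leaving colors, a crossing relation right and left ones; the sign
    decides which is which. *)
Lemma slide_relation (s : bool) (b c c' : F) :
  (slide t s b c == c') =
  ((if s then c' else c) == t * (if s then c else c') + (1 - t) * b).
Proof.
have E c1 : t * c1 + (1 - t) * b = slide t true b c1.
  by rewrite /slide; ring.
by case: s; rewrite E [RHS]eq_sym // slide_eq // eq_sym.
Qed.

Lemma run_of_arcs (f : 'I_(narcs w) -> F) h : arc_coloring t f ->
  (forall x, x \in unders w -> h (crossing x) = f (over_arc w x)) ->
  forall i, (i <= size w)%N -> run t h (f ord0) (take i w) = f (arc_at w i).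
Proof.
move=> f_col hf; elim=> [|i IHi] lt_i; first by rewrite take0 arc_at0.
rewrite runS // IHi 1?ltnW //; set x := nth x0 w i; rewrite /pass.
case: ifP => Ox; first by rewrite arc_atS.
have wx : x \in w by rewrite mem_nth.
have Ux : x \in unders w by rewrite mem_filter /is_under Ox.
apply/eqP; rewrite slide_relation hf //; apply/eqP.
have := f_col x Ux; rewrite /left_under /right_under index_nth //.
by case: (positive x); rewrite /= addn0 addn1.
Qed.

Lemma arcs_of_run h c : coloring t h c w ->
  exists f : 'I_(narcs w) -> F,
    forall i, (i <= size w)%N -> f (arc_at w i) = run t h c (take i w).
Proof.
case/andP=> _ /eqP run_w.
have run_under v : run t h c v = run t h c (unders v).
  rewrite /run; elim: v (c) => //= x v IHv y.
  by rewrite IHv /is_under /pass; case: ifP => Ox //=; rewrite /pass Ox.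
exists (fun j => run t h c (take j (unders w))) => i le_i.
have -> : run t h c (take i w) = run t h c (take (count is_under (take i w)) (unders w)).
  rewrite run_under; congr (run _ _ _ _).
  have -> : unders w = unders (take i w) ++ unders (drop i w).
    by rewrite -filter_cat cat_take_drop.
  by rewrite take_size_cat // size_filter.
have : (count is_under (take i w) <= size (unders w))%N.
  by rewrite size_filter -[w in leqRHS](cat_take_drop i) count_cat leq_addr.
(* Past the last under-passage the arc number wraps around to 0, and the color agrees because the
   coloring closes up. *)
rewrite leq_eqVlt /= => /predU1P[->|lt_s]; last first.
  by rewrite modn_small // (leq_trans lt_s) // leqSpred.
rewrite take_size -run_under run_w.
by case: (size _) => [|n]; rewrite ?mod0n ?modnn take0.
Qed.

(** Arc colorings and the colorings given by [h] and [c] are the same data: [h] records the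
    over-arcs and [c] is the color of arc 0. *)
Lemma rigidP : rigid t w <->
  (forall f : 'I_(narcs w) -> F, arc_coloring t f -> forall i j, f i = f j).
Proof.
split=> [w_rigid f f_col|f_const h c hc_col].
  pose h a := f (arc_at w (index (a, true) [seq key x | x <- w])).
  have hf x : x \in unders w -> h (crossing x) = f (over_arc w x).
    rewrite mem_filter => /andP[Ux wx]; rewrite /h /over_arc -index_key ?mem_mate //.
    by rewrite /key /mate /=; move: Ux; rewrite /is_under => ->.
  have run_f := run_of_arcs f_col hf.
  have/w_rigid w_const: coloring t h (f ord0) w.
    rewrite /coloring -[w in run _ _ _ w]take_size run_f // arc_at_size eqxx andbT.
    apply/consistentP=> i lt_i Oi; rewrite run_f 1?ltnW //.
    congr (f (arc_at w _)); rewrite -[in RHS](index_nth lt_i) -index_key ?mem_nth //.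
    by rewrite /key Oi.
  suff f0 i : f i = f ord0 by move=> i j; rewrite !f0.
  have [k le_k ->] := arc_at_surj i; rewrite -run_f // run_constant //.
  apply/allP=> x /mem_take; exact: (allP w_const).
have [f fE] := arcs_of_run hc_col; case/andP: (hc_col) => /consistentP h_ok _.
have hE x : x \in w -> is_over x -> h (crossing x) = f (arc_at w (index x w)).
  move=> wx Ox; rewrite fE ?index_size // -h_ok ?index_mem ?nth_index //.
have /f_const f_eq: arc_coloring t f.
  move=> x; rewrite mem_filter => /andP[Ux wx].
  rewrite /over_arc -hE ?mem_mate //= -/(crossing x).
  have lt_i : (index x w < size w)%N by rewrite index_mem.
  have /esym/eqP: f (arc_at w (index x w).+1)
      = slide t (positive x) (h (crossing x)) (f (arc_at w (index x w))).
    rewrite (fE _ lt_i) (fE _ (ltnW lt_i)) runS // nth_index // /pass.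
    by rewrite -if_neg -/(is_under x) Ux.
  rewrite slide_relation /left_under /right_under => /eqP.
  by case: (positive x); rewrite /= addn0 addn1.
(* Consistency constrains [h] at over-passages only, but these reach every crossing. *)
apply/allP; apply: (@over_ind (fun a => h a == c)) => x wx Ox.
rewrite hE // (f_eq _ (arc_at w 0)) fE // take0 //.
Qed.

End Arcs.

(** At t = 1 passing under does not change the color, so a single component has a single color. *)
Lemma rigid1 (F : fieldType) (w : seq passage) : gauss_code w -> rigid (1 : F) w.
Proof.
move=> w_gauss h c /andP[/(consistentP 1) h_ok _].
have pass1 x : pass 1 h c x = c.
  by rewrite /pass /slide invr1 if_same mul1r addrC subrK if_same.
have run1 v : run 1 h c v = c by elim: v => //= x v IHv; rewrite pass1.
apply/allP; apply: (@over_ind _ w_gauss (fun a => h a == c)) => x wx Ox; apply/eqP.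
by rewrite -(nth_index (0%N, true, true) wx) h_ok ?index_mem ?nth_index // run1.
Qed.

(** * Determinants of systems of relations *)

Section Relations.

Variables (N k : nat) (l r o : 'I_N -> 'I_k.+1) (m : int).

(** The elements of ['I_k.+1] will be the arcs of a diagram, and later the colors of a coloring. *)
Definition solution (F : fieldType) (y : 'I_k.+1 -> F) : Prop :=
  forall i, y (l i) = m%:~R * y (r i) + (1 - m%:~R) * y (o i).

Definition solution_rigid (F : fieldType) : Prop :=
  forall y : 'I_k.+1 -> F, solution y -> forall u v, y u = y v.

(* The unit vector at u, with the coordinate of the vertex 0 left out: solutions
   only matter up to constants. *)
Definition vertex (u : 'I_k.+1) : 'rV[int]_k := \row_j (lift ord0 j == u)%:R.

Definition relation_matrix : 'M[int]_(N, k) :=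
  \matrix_i (vertex (l i) - m *: vertex (r i) - (1 - m) *: vertex (o i)).

Definition extend (F : fieldType) (v : 'cV[F]_k) (u : 'I_k.+1) : F :=
  if unlift ord0 u is Some j then v j 0 else 0.

Lemma extend0 (F : fieldType) (v : 'cV[F]_k) : extend v ord0 = 0.
Proof. by rewrite /extend unlift_none. Qed.

Lemma extend_lift (F : fieldType) (v : 'cV[F]_k) j :
  extend v (lift ord0 j) = v j 0.
Proof. by rewrite /extend liftK. Qed.

Lemma vertex_mul (F : fieldType) (v : 'cV[F]_k) u :
  map_mx intr (vertex u) *m v = (extend v u)%:M.
Proof.
rewrite [LHS]mx11_scalar mxE; congr _%:M.
case: (unliftP ord0 u) => [j ->|->]; rewrite ?extend_lift ?extend0.
  rewrite (bigD1 j) //= big1 => [|i ij]; rewrite !mxE ?eqxx ?mul1r ?addr0 //.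
  by rewrite (inj_eq lift_inj) (negPf ij) mul0r.
by rewrite big1 // => i _; rewrite !mxE eq_sym (negPf (neq_lift _ _)) mul0r.
Qed.

Lemma relation_mul (F : fieldType) (v : 'cV[F]_k) :
  (map_mx intr relation_matrix *m v == 0) <-> solution (extend v).
Proof.
have rowE i : row i (map_mx intr relation_matrix *m v) =
    (extend v (l i) - m%:~R * extend v (r i) - (1 - m%:~R) * extend v (o i))%:M.
  rewrite row_mul -map_row rowK !(map_mxB, map_mxZ) /= !mulmxBl -!scalemxAl.
  by rewrite !vertex_mul rmorphB /= !raddfB /= !scale_scalar_mx.
split=> [/eqP A0 i|v_sol].
  have /matrixP/(_ 0 0) := rowE i; rewrite A0 row0 !mxE mulr1n.
  by move/esym/eqP; rewrite -addrA -opprD subr_eq0 => /eqP.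
by apply/eqP/row_matrixP=> i; rewrite rowE row0 v_sol -addrA -opprD subrr raddf0.
Qed.

(** Subtracting [y ord0] from a solution puts it in the kernel of the matrix, so all solutions are
    constant iff the kernel is trivial. *)
Lemma row_full_relation (F : fieldType) :
  row_full (map_mx intr relation_matrix : 'M[F]_(N, k)) <-> solution_rigid F.
Proof.
rewrite -cokermx_eq0; set A := map_mx _ _; split=> [A_full y y_sol|A_rigid].
  suff y0 u : y u = y ord0 by move=> u v; rewrite !y0.
  pose v : 'cV[F]_k := \col_j (y (lift ord0 j) - y ord0).
  have vE w : extend v w = y w - y ord0.
    by case: (unliftP ord0 w) => [j ->|->]; rewrite ?extend_lift ?extend0 ?mxE ?subrr.
  have /relation_mul/eqP Av: solution (extend v).
    by move=> i; rewrite !vE y_sol; ring.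
  apply/eqP; rewrite -subr_eq0 -vE; suff -> : v = 0.
    by rewrite /extend; case: unlift => // j; rewrite mxE.
  move: A_full; rewrite cokermx_eq0 => /row_fullP[B BA].
  by rewrite -[v]mul1mx -BA -mulmxA Av mulmx0.
apply/eqP/matrixP=> i j; rewrite [RHS]mxE; pose v := col j (cokermx A).
have v_sol: solution (extend v).
  by apply/relation_mul; rewrite -/A /v colE mulmxA mulmx_coker mul0mx.
by have := A_rigid _ v_sol (lift ord0 i) ord0; rewrite extend_lift extend0 mxE.
Qed.

(** The same integer minors serve for every [F], which allows rigidity over [rat] and over prime
    fields to be compared. *)
Lemma relation_minorP (F : fieldType) :
  solution_rigid F <->
  exists g : 'I_k -> 'I_N, (\det (rowsub g relation_matrix))%:~R != 0 :> F.
Proof.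
rewrite -row_full_relation; set A := map_mx _ _.
have minorE g : (\det (rowsub g relation_matrix))%:~R = \det (rowsub g A) :> F.
  by rewrite -map_mxsub det_map_mx.
split=> [A_full|[g]].
  exists (fullrankfun A_full); rewrite minorE -unitfE -unitmxE.
  exact: fullrowsub_unit.
rewrite minorE -unitfE -unitmxE -row_full_unit -!sub1mx => /submx_trans; apply.
exact: rowsub_sub.
Qed.

End Relations.

Lemma row_full_det (F : fieldType) k (l r o : 'I_k -> 'I_k.+1) m :
  solution_rigid l r o m F <-> (\det (relation_matrix l r o m))%:~R != 0 :> F.
Proof. by rewrite -row_full_relation row_full_unit unitmxE unitfE det_map_mx. Qed.

(* Whether a graph with k edges on k + 1 vertices is connected does not depend on
   the field, so no prime divides a nonzero determinant. *)
Lemma det_edges k (a b : 'I_k -> 'I_k.+1) :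
  `|\det (\matrix_i (vertex (a i) - vertex (b i)))| <= 1 :> int.
Proof.
have -> : \matrix_i (vertex (a i) - vertex (b i)) = relation_matrix a b b 1.
  by apply/row_matrixP=> i; rewrite !rowK scale1r subrr scale0r subr0.
set d := \det _; rewrite leNgt; apply/negP => d_gt1.
have q_prime : prime (pdiv `|d|) by rewrite pdiv_prime // -ltz_nat abszE.
have : (pdiv `|d| %| d)%Z by rewrite dvdzE /= pdiv_dvd.
rewrite (dvdz_pcharf (pchar_Fp q_prime)); apply/negP/row_full_det.
have /row_full_det rigidQ : d%:~R != 0 :> rat.
  by rewrite intr_eq0 -normr_gt0 (lt_trans _ d_gt1).
(* For m = 1 a solution takes equal values at the ends of each edge, so the indicator of a level set
   of [y] is a rational solution. *)
move=> y y_sol u v; pose z w : rat := (y w == y v)%:R.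
have /rigidQ/(_ u v) : solution a b b 1 z.
  by move=> i; rewrite /z y_sol subrr !mul1r !mul0r !addr0.
by rewrite /z eqxx; case: eqP => // _ /eqP; rewrite eq_sym oner_eq0.
Qed.

(** Expanding the rows one by one by multilinearity, each row multiplies the bound by 1 + c. *)
Lemma det_row_sums (n c : nat) (S : 'rV[int]_n -> Prop) :
  (forall B : 'M_n, (forall i, S (row i B)) -> `|\det B| <= 1) ->
  forall B : 'M_n,
    (forall i, exists u v, [/\ S u, S v & row i B = u + c%:Z *: v]) ->
  `|\det B| <= c.+1%:Z ^+ n.
Proof.
move=> S_det.
(* In the induction the first [s] rows are sums and the others already lie in [S]. *)
suff H s (B : 'M_n) : (s <= n)%N ->
    (forall i : 'I_n, (s <= i)%N -> S (row i B)) ->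
    (forall i : 'I_n, (i < s)%N ->
      exists u v, [/\ S u, S v & row i B = u + c%:Z *: v]) ->
    `|\det B| <= c.+1%:Z ^+ s.
  move=> B B_sum; apply: H => // i; by rewrite leqNgt ltn_ord.
elim: s B => [|s IHs] B lt_s SB B_sum.
  by rewrite expr0; apply: S_det => i; apply: SB.
pose i0 := Ordinal lt_s.
have [//|u [v [Su Sv Brow]]] := B_sum i0.
pose C w := \matrix_i (if i == i0 then w else row i B) : 'M[int]_n.
have CE w i : row i (C w) = if i == i0 then w else row i B by rewrite rowK.
have C_det w : S w -> `|\det (C w)| <= c.+1%:Z ^+ s.
  move=> Sw; apply: IHs (ltnW lt_s) _ _ => i; rewrite CE; case: eqP => [->|/eqP Ni] //=.
    by move=> le_si; apply: SB; rewrite ltn_neqAle eq_sym Ni.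
    by rewrite ltnn.
  by move=> lt_is; apply: B_sum; rewrite (ltn_trans lt_is).
have C' w : row' i0 (C w) = row' i0 B.
  by apply/matrixP=> i j; rewrite !mxE eq_sym (negPf (neq_lift _ _)) mxE.
rewrite (@determinant_multilinear _ _ B (C u) (C v) i0 1 c%:Z) ?C' //; last first.
  by rewrite !CE eqxx scale1r.
rewrite mul1r (le_trans (ler_normD _ _)) // normrM exprS intS mulrDl mul1r.
by rewrite lerD ?C_det // ler_wpM2l ?C_det.
Qed.

Lemma det_relations k (l r o : 'I_k -> 'I_k.+1) (m : int) : m != 0 -> m != 1 ->
  (`|\det (relation_matrix l r o m)| <= (maxn `|m| `|m - 1|) ^ k)%N.
Proof.
move=> m0 m1.
pose S u := exists e : 'I_k.+1 * 'I_k.+1, u = vertex e.1 - vertex e.2.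
have S_det (B : 'M_k) : (forall i, S (row i B)) -> `|\det B| <= 1.
  move=> /fin_all_exists[e Be].
  rewrite (_ : B = \matrix_i (vertex (e i).1 - vertex (e i).2)); first exact: det_edges.
  by apply/row_matrixP=> i; rewrite rowK Be.
have bound c B : (forall i, exists u v, [/\ S u, S v & row i B = u + c%:Z *: v]) ->
    maxn `|m| `|m - 1| = c.+1 -> (`|\det B| <= (maxn `|m| `|m - 1|) ^ k)%N.
  move=> B_sum ->; rewrite -lez_nat abszE -[Posz (_ ^ _)]natz natrX natz.
  exact: det_row_sums B_sum.
(* [M] is m in the first case and 1 - m in the second, and c = M - 1 in both. *)
have [m_gt1|m_lt0] : (1 < m) \/ (m < 0) by lia.
  (* e_l - m e_r - (1 - m) e_o = (e_l - e_r) + (m - 1) (e_o - e_r) *)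
  apply: (@bound (`|m|.-1)) => [i|]; last by lia.
  exists (vertex (l i) - vertex (r i)), (vertex (o i) - vertex (r i)).
  split; [by exists (l i, r i)|by exists (o i, r i)|].
  have -> : `|m|.-1%:Z = m - 1 by lia.
  by rewrite rowK; apply/rowP=> j; rewrite !mxE; ring.
(* e_l - m e_r - (1 - m) e_o = (e_l - e_o) + |m| (e_r - e_o) *)
apply: (@bound `|m|%N) => [i|]; last by lia.
exists (vertex (l i) - vertex (o i)), (vertex (r i) - vertex (o i)).
split; [by exists (l i, o i)|by exists (r i, o i)|].
have -> : `|m|%N%:Z = - m by lia.
by rewrite rowK; apply/rowP=> j; rewrite !mxE; ring.
Qed.

Lemma prime_le_det N k (l r o : 'I_N -> 'I_k.+1) (m : int) p (y : 'I_k.+1 -> 'F_p) :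
  prime p -> m != 0 -> m != 1 -> solution_rigid l r o m rat ->
  solution l r o m y -> (exists u v, y u != y v) ->
  (p <= (maxn `|m| `|m - 1|) ^ k)%N.
Proof.
move=> p_prime m0 m1 /relation_minorP[g]; set d := \det _.
rewrite intr_eq0 => d0 y_sol [u [v yuv]].
have p_d : (p %| d)%Z.
  rewrite (dvdz_pcharf (pchar_Fp p_prime)); apply: contraNT yuv => d_p.
  by apply/eqP; apply: (relation_minorP l r o m _).2 y_sol u v; exists g.
apply: leq_trans (dvdn_leq _ p_d) _; first by rewrite absz_gt0.
have -> : d = \det (relation_matrix (l \o g) (r \o g) (o \o g) m).
  by congr (\det _); apply/row_matrixP=> i; rewrite row_rowsub !rowK.
exact: det_relations.
Qed.

(** * The Alexander matrix and the number of colors *)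

Section ArcRelations.

Variables (w : seq passage) (m : int).

Let x i := tnth (in_tuple (unders w)) i.

Definition left_arc i : 'I_(narcs w) := left_under w (x i).
Definition right_arc i : 'I_(narcs w) := right_under w (x i).
Definition upper_arc i : 'I_(narcs w) := over_arc w (x i).

Lemma arc_coloringP (F : fieldType) (f : 'I_(narcs w) -> F) :
  arc_coloring m%:~R f <-> solution left_arc right_arc upper_arc m f.
Proof.
split=> [f_col i|f_sol y /(tnthP (in_tuple _))[i ->]]; last exact: f_sol.
exact/f_col/mem_tnth.
Qed.

Lemma rigid_solutionP (F : fieldType) : gauss_code w -> m%:~R != 0 :> F ->
  rigid (m%:~R : F) w <-> solution_rigid left_arc right_arc upper_arc m F.
Proof.
move=> w_gauss m0; apply: iff_trans (rigidP m0 w_gauss) _.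
by split=> f_const f /arc_coloringP; apply: f_const.
Qed.

(** Restores the coordinate of the vertex 0: [vertex u] is sent to e_0 - e_u, which accounts for the
    opposite signs in the Alexander matrix. *)
Definition difference_matrix k : 'M[int]_(k, k.+1) :=
  \matrix_(j, u) ((u == ord0)%:R - (u == lift ord0 j)%:R).

Lemma vertex_difference k (u : 'I_k.+1) :
  vertex u *m difference_matrix k = \row_v ((v == ord0)%:R - (v == u)%:R).
Proof.
apply/rowP=> v; rewrite !mxE; case: (unliftP ord0 u) => [j ->|->].
  rewrite (bigD1 j) //= big1 => [|i ij]; rewrite !mxE ?eqxx ?mul1r ?addr0 //.
  by rewrite (inj_eq lift_inj) (negPf ij) mul0r.
by rewrite subrr big1 // => i _; rewrite !mxE eq_sym (negPf (neq_lift _ _)) mul0r.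
Qed.

(* The coefficients of a relation sum to 0. *)
Lemma alexander_factor :
  map_mx (horner_eval m) (alexander_matrix w) =
  relation_matrix left_arc right_arc upper_arc m *m difference_matrix _.
Proof.
apply/row_matrixP=> i; rewrite row_mul rowK !mulmxBl -!scalemxAl.
rewrite !vertex_difference; apply/rowP=> v.
rewrite !mxE /horner_eval -/(x i) -/(left_arc i) -/(right_arc i) -/(upper_arc i).
by rewrite !(hornerE, hornerMn); do 4!case: eqP => _ /=; ring.
Qed.

(** Hence all first minors of the Alexander matrix vanish at T = m as soon as those of the relation
    matrix do. *)
Lemma minor_horner g h :
  (minor g h).[m] = \det (rowsub g (relation_matrix left_arc right_arc upper_arc m))
    * \det (colsub h (difference_matrix _)) :> int.
Proof.
rewrite -det_mulmx -mxsub_mul -alexander_factor -map_mxsub det_map_mx.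
by rewrite /= /horner_eval.
Qed.

(** Otherwise X - m divides every first minor, hence also [P] up to a power of X, and [P] vanishes
    at m because m is nonzero. *)
Lemma alexander_rigid P : gauss_code w -> m != 0 ->
  (forall Q, (forall g h, laurent_dvd Q (@minor w g h)) -> laurent_dvd Q P) ->
  P.[m] != 0 -> rigid (m%:~R : rat) w.
Proof.
move=> w_gauss m0 P_gcd Pm; have mQ : m%:~R != 0 :> rat by rewrite intr_eq0.
apply/(rigid_solutionP w_gauss mQ)/relation_minorP; apply: contrapT => no_minor.
have /P_gcd[k [R /(congr1 (horner^~ m))]]:
    forall g h, laurent_dvd ('X - m%:P) (@minor w g h).
  move=> g h; have : root (minor g h) m.
    rewrite /root minor_horner mulf_eq0; apply/orP; left.
    by apply: contra_notT no_minor => g_minor; exists g; rewrite intr_eq0.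
  by case/factor_theorem=> Q ->; exists 0%N, Q; rewrite expr0 mul1r mulrC.
rewrite !hornerE subrr mul0r => /eqP; rewrite mulf_eq0 (negPf Pm) orbF.
by rewrite expf_eq0 (negPf m0) andbF.
Qed.

Lemma rational_rigid : gauss_code w -> m != 0 -> m != 1 -> m != 2 ->
  rigid (m%:~R : rat) w.
Proof.
move=> w_gauss m0 m1 m2; pose q := pdiv `|m - 1|.
(* |m - 1| exceeds 1 because m is not 0, 1 or 2. *)
have q_prime : prime q by apply: pdiv_prime; lia.
have mq : m%:~R = 1 :> 'F_q.
  apply/eqP; rewrite -subr_eq0 -[1]/(1%:~R) -rmorphB.
  by rewrite -(dvdz_pcharf (pchar_Fp q_prime)) dvdzE /= pdiv_dvd.
have mq0 : m%:~R != 0 :> 'F_q by rewrite mq oner_neq0.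
have mQ0 : m%:~R != 0 :> rat by rewrite intr_eq0.
apply/(rigid_solutionP w_gauss mQ0)/relation_minorP.
have /(rigid_solutionP w_gauss mq0)/relation_minorP[g g_minor] : rigid (m%:~R : 'F_q) w.
  by rewrite mq; apply: rigid1.
by exists g; rewrite intr_eq0; apply: contraNneq g_minor => ->.
Qed.

End ArcRelations.

(** * Number of colors of a coloring of one diagram *)

Section Colors.

Variables (p : nat) (m : int) (w : seq passage) (f : {ffun 'I_(narcs w) -> 'F_p}).
Hypotheses (p_prime : prime p) (w_gauss : gauss_code w).
Hypotheses (m0 : m%:~R != 0 :> 'F_p) (m1 : m%:~R != 1 :> 'F_p).
Hypotheses (f_col : arc_coloring m%:~R f) (f_nontriv : (1 < ncolors f)%N).

(** If the two under-arcs at some crossing differ in color, the over-arc has a third color since m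
    is nonzero modulo p. If they never differ, the coloring is constant along the knot. *)
Lemma ncolors_gt2 : (2 < ncolors f)%N.
Proof.
rewrite ltnNge; apply/negP=> f_le2.
have f_col1 : arc_coloring 1 f.
  move=> y y_under; rewrite subrr mul0r addr0 mul1r; apply: contraTeq f_le2 => lr.
  set l := left_under w y in lr *; set r := right_under w y in lr *.
  have := f_col y_under; rewrite -/l -/r; set o := over_arc w y => f_rel.
  rewrite -ltnNge; apply/card_gt2P; exists (f l), (f r), (f o).
  split; split; rewrite ?codom_f //; apply: contraNneq lr => e.
    by rewrite f_rel e -mulrDl addrC subrK mul1r.
  have: m%:~R * (f r - f o) == 0.
    rewrite mulrBr subr_eq0 -(inj_eq (addIr ((1 - m%:~R) * f o))) -f_rel -e.
    by rewrite -mulrDl addrC subrK mul1r.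
  by rewrite mulf_eq0 (negPf m0) subr_eq0 -e eq_sym.
case/card_gt1P: f_nontriv => a [b [/codomP[i ->] /codomP[j ->]]] /eqP; case.
exact: (rigidP (oner_neq0 _) w_gauss).1 (rigid1 w_gauss) f f_col1 i j.
Qed.

Lemma prime_lt_ncolors : rigid (m%:~R : rat) w ->
  (p < (maxn `|m| `|m - 1|) ^ (ncolors f).-1)%N.
Proof.
move=> w_rigid; have n_gt2 := ncolors_gt2.
have mZ0 : m != 0 by apply: contraNneq m0 => ->.
have mZ1 : m != 1 by apply: contraNneq m1 => ->.
have mQ0 : m%:~R != 0 :> rat by rewrite intr_eq0.
set M := maxn _ _; have M_gt1 : (1 < M)%N by lia.
suff : (p <= M ^ (ncolors f).-1)%N.
  (* If p were M ^ (n - 1), its divisor M > 1 would be p itself, contradicting n - 1 >= 2. *)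
  rewrite leq_eqVlt => /predU1P[p_eq|//].
  have M_p : (M %| p)%N by rewrite p_eq dvdn_exp //; lia.
  move: (p_prime) => /primeP[_ /(_ M M_p)]; rewrite gtn_eqF //= => /eqP Mp.
  have : (M ^ 2 <= M ^ (ncolors f).-1)%N by rewrite leq_exp2l //; lia.
  rewrite -p_eq -Mp; nia.
set k := _.-1; have nE : ncolors f = k.+1 by rewrite prednK //; lia.
pose s := enum (codom f).
have s_size : size s = k.+1 by rewrite -cardE.
(* [c] merges the arcs of equal color and [y] gives the color back; the relations pass to the
   quotient. *)
pose c a : 'I_k.+1 := inord (index (f a) s).
pose y (j : 'I_k.+1) := s`_j.
have fs a : f a \in s by rewrite mem_enum codom_f.
have yc a : y (c a) = f a by rewrite /y inordK ?nth_index // -s_size index_mem.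
have c_surj j : exists a, j = c a.
  have : s`_j \in s by rewrite mem_nth // s_size.
  rewrite mem_enum => /codomP[a ja]; exists a; apply: val_inj.
  by rewrite /= inordK -ja index_uniq ?enum_uniq ?s_size.
apply: (@prime_le_det _ _ (c \o @left_arc w) (c \o @right_arc w)
  (c \o @upper_arc w) m p y) => //.
(* A rational solution in the colors pulls back along [c] to one in the arcs, which is constant. *)
- move=> z z_sol u v; have [a ->] := c_surj u; have [b ->] := c_surj v.
  have/(rigid_solutionP w_gauss mQ0) w_sol := w_rigid.
  exact: (w_sol (z \o c)).
- by move=> i; rewrite /= !yc; have/arc_coloringP := f_col; apply.
exists ord0, ord_max; rewrite /y nth_uniq ?enum_uniq ?s_size //=; lia.
Qed.

End Colors.

(** * Passage to all the diagrams of a knot *)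

Lemma knot_reidemeister (K : knot) (D E : diagram) : K D -> K E -> reidemeister D E.
Proof.
have [D0 ->] := diagrams_ofP K => KD KE.
exact: rst_trans (rst_sym _ _ _ _ KD) KE.
Qed.

Theorem theorem1p2 (K : knot) (p : nat) (m : int)
  (p_prime : prime p) (p_odd : odd p) (pNm : ~~ (p%:Z %| m)%Z)
  (Kcol : admits_nontrivial_colorings p m K)
  (hm : m <> 2 \/ (m = 2 /\ (reduced_alexander K).[m] <> 0)) :
  (2 + trunc_log (maxn `|m| `|m - 1|) p <= mincol p m K)%N.
Proof.
have m0 : m%:~R != 0 :> 'F_p by rewrite -(dvdz_pcharf (pchar_Fp p_prime)).
have colE D f : @pm_coloring p m D f <-> arc_coloring m%:~R f.
  by rewrite /pm_coloring rmorphB.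
have mZ0 : m != 0 by apply: contraNneq m0 => ->.
have mQ0 : m%:~R != 0 :> rat by rewrite intr_eq0.
have not_rigid (D : diagram) : K D -> ~ rigid (m%:~R : 'F_p) D.
  have [E KE [f [/colE f_col /card_gt1P[a [b []]]]]] := Kcol.
  move=> /codomP[i ->] /codomP[j ->] /eqP Nij KD D_rigid; apply: Nij.
  have /(rigidP m0 (code_gauss E)) E_rigid : rigid (m%:~R : 'F_p) E.
    exact: (rigid_reidemeister m0 (knot_reidemeister KD KE)).1.
  exact: E_rigid.
have m1 : m%:~R != 1 :> 'F_p.
  have [E KE _] := Kcol; apply: contra_notN (not_rigid E KE) => /eqP->.
  exact: rigid1 (code_gauss E).
have mZ1 : m != 1 by apply: contraNneq m1 => ->.
have rigidQ (D : diagram) : K D -> rigid (m%:~R : rat) D.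
  move=> KD; case: (eqVneq m 2) hm => [m2|m2 _]; last first.
    exact: rational_rigid (code_gauss D) mZ0 mZ1 m2.
  case=> [//|[_ /eqP]]; rewrite /reduced_alexander.
  (* If no polynomial qualified, [reduced_alexander K] would be 0, against the assumption. The
     diagram [E] of [P] may differ from [D]. *)
  case: xgetP => [P _ [[E KE [_ P_gcd]] _] Pm|_]; last by rewrite horner0 eqxx.
  apply: (rigid_reidemeister mQ0 (knot_reidemeister KD KE)).2.
  exact: alexander_rigid (code_gauss E) mZ0 P_gcd Pm.
have bound (D : diagram) : K D ->
    (2 + trunc_log (maxn `|m| `|m - 1|) p <= min_colors p m D)%N.
  move=> KD; rewrite /min_colors; set S := (X in least X).
  (* The set of numbers of colors is nonempty, so [least] does not take its default value 0. *)
  have [f0 [f0_col f0_nontriv]] :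
      exists f : {ffun 'I_(narcs D) -> 'F_p}, nontrivial_coloring m f.
    apply: contrapT => no_col; apply: (not_rigid D KD).
    apply/(rigidP m0 (code_gauss D)) => f f_col i j; apply: contrapT => /eqP ij.
    apply: no_col; exists (finfun f); split.
      by apply/colE=> y y_under; rewrite !ffunE; apply: f_col.
    apply/card_gt1P; exists (f i), (f j).
    by split=> //; apply/codomP; [exists i|exists j]; rewrite ffunE.
  have [|[f [/colE f_col f_nontriv] ->] _] := @leastP S (ncolors f0); first by exists f0.
  have p_lt := prime_lt_ncolors p_prime (code_gauss D) m0 m1 f_col f_nontriv
    (rigidQ D KD).
  have M_gt1 : (1 < maxn `|m| `|m - 1|)%N by lia.
  (* M ^ ([trunc_log] M p) <= p < M ^ (n - 1), so the logarithm is at most n - 2. *)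
  have := leq_ltn_trans (trunc_logP M_gt1 (prime_gt0 p_prime)) p_lt.
  rewrite ltn_exp2l //; lia.
have [D KD _] := Kcol; rewrite /mincol.
set S := (X in least X).
have [|[E KE ->] _] := @leastP S (min_colors p m D); first by exists D.
exact: bound.
Qed.
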